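(* Let $\hat{p}=\{p_n:n\in\omega\}$ with $p_n\in(0,\tfrac12]$ for all $n$, and let ${\cal F}$ be a nonprincipal filter on $\omega$. The following are equivalent: (1) ${\cal F}$ is $\mu_{\hat p}$-measurable; (2) there exists a family $\{{\cal A}_n:n\in\omega\}$ such that (a) each ${\cal A}_n$ consists of finitely many finite subsets of $\omega$; (b) $\bigcup{\cal A}_n\cap\bigcup{\cal A}_m=\emptyset$ whenever $n\neq m$; (c) $\sum_{n=1}^\infty\mu_{\hat p}(\{X\subseteq\omega:\exists a\in{\cal A}_n\ a\subseteq X\})<\infty$; (d) for every $X\in{\cal F}$ there are infinitely many $n$ such that some $a\in{\cal A}_n$ satisfies $a\subseteq X$.
   Context: Subsets of $\omega$ are identified with their characteristic functions, so filters on $\omega$ are subsets of $2^\omega$. $\mu_{\hat p}$ is the product measure on $2^\omega$ with $\mu_{\hat p}(\{x:x(n)=1\})=p_n$ and $\mu_{\hat p}(\{x:x(n)=0\})=1-p_n$. *)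

(* Defs.v *)
From HB Require Import structures.
From mathcomp Require Import all_boot all_order all_algebra.
From mathcomp Require Import all_classical all_reals all_analysis.
Set Implicit Arguments. Unset Strict Implicit. Unset Printing Implicit Defensive.
Import Order.TTheory GRing.Theory Num.Theory.
Local Open Scope classical_set_scope.
Local Open Scope ring_scope.

(* Subsets of omega are identified with characteristic functions nat -> bool;
   2^omega is (nat -> bool). *)

Definition cyl (s : seq bool) : set (nat -> bool) :=
  [set x | forall i, (i < size s)%N -> x i = nth false s i].

Definition cyl_weight (R : realType) (p : nat -> R) (s : seq bool) : R :=
  \prod_(i < size s) (if nth false s i then p i else 1 - p i).

Definition mu_star (R : realType) (p : nat -> R) (A : set (nat -> bool)) : \bar R :=
  ereal_inf [set (\sum_(0 <= k <oo) (cyl_weight p (c k))%:E)%E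
            | c in [set c : nat -> seq bool | A `<=` \bigcup_k cyl (c k)]].

(* mu_p-measurable = measurable for the completed product measure
   = Caratheodory measurable w.r.t. the outer measure. *)
Definition mu_measurable (R : realType) (p : nat -> R) (A : set (nat -> bool)) :=
  (mu_star p).-caratheodory A.

Definition nonprincipal_filter (F : set (nat -> bool)) : Prop :=
  [/\ ~ F (fun _ => false),
      forall X Y : nat -> bool, F X -> (forall i, X i -> Y i) -> F Y,
      forall X Y : nat -> bool, F X -> F Y -> F (fun i => X i && Y i)
    & forall X, finite_set [set i | ~~ X i] -> F X].

Definition hits (A : set (set nat)) : set (nat -> bool) :=
  [set X | exists2 a, A a & forall i, a i -> X i].

(* Main.v *)
Require Import Defs.
From HB Require Import structures.
From mathcomp Require Import all_boot all_order all_algebra.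
From mathcomp Require Import all_classical all_reals all_analysis.
From mathcomp Require Import lra zify ring.
Set Implicit Arguments.
Unset Strict Implicit.
Unset Printing Implicit Defensive.
Import Order.TTheory GRing.Theory Num.Theory.
Local Open Scope classical_set_scope.
Local Open Scope ring_scope.

(* A nonprincipal filter [F] is a tail set, so its outer measure is [0] or [1].
   If [F] is measurable of outer measure [1], its complement is null; since
   [p n <= 1/2], two disjoint sets, each avoiding a small cover of the
   complement, can be built coordinate by coordinate, and both lie in [F]:
   contradiction.  So [F] is null.

   A null set lies in the limsup of events [E j] where [E j] depends only on two
   consecutive blocks [b j], [b j.+1] of coordinates and has tiny probability.
   Say that [X] is bad on an odd block if, given [X] there, one of the two events
   involving this block is too likely; by Markov this is a small event on that
   block.  If some [X] in [F] is bad only finitely often, let [T k] be the event,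
   on the even block [b k.*2.+2], that its outcome together with the values of
   [X] on the two adjacent blocks realizes one of the two events involving it.
   If some [X'] in [F] realizes only finitely many [T k], then the set equal to
   [X'] on even blocks and to [X] elsewhere contains the intersection of [X] and
   [X'], hence lies in [F], but realizes only finitely many [E j]: contradiction.
   Thus [F] lies in the limsup of summable events on disjoint blocks, which may be
   replaced by the upward closed sets of those [x] all of whose supersets realize
   the event. *)

(** * Infinite subsets of [nat] and reordering of double series *)

Lemma infinite_natP (S : set nat) :
  infinite_set S <-> forall N, exists2 n, (N <= n)%N & S n.
Proof.
split=> [infS N|h finS].
  apply: contrapT => noS; apply: infS.
  apply: sub_finite_set (finite_II N) => n Sn /=.
  by rewrite ltnNge; apply/negP => Nn; apply: noS; exists n.
have [N NP] : exists N, forall n, S n -> (n <= N)%N.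
  have /finite_seqP[X XE] := finS.
  exists (\max_(i <- X) i)%N => n; rewrite XE /= => nX.
  exact: (@leq_bigmax_seq _ X xpredT id).
by have [n nN /NP] := h N.+1; rewrite leqNgt nN.
Qed.

Lemma esum_flatten (R : realType) (f : nat -> nat * nat) (a : nat -> nat -> \bar R) :
  set_bij setT setT f -> (forall i j, 0 <= a i j)%E ->
  (\sum_(k <oo) a (f k).1 (f k).2 = \sum_(i <oo) \sum_(j <oo) a i j)%E.
Proof.
move=> fbij a0.
rewrite nneseries_esumT; last by move=> k; exact: a0.
rewrite nneseries_esumT; last by move=> k; apply: nneseries_ge0 => *; exact: a0.
under [RHS]eq_esum do rewrite nneseries_esumT//.
rewrite esum_esum//.
rewrite [RHS](_ : _ = \esum_(k in setT) a k.1 k.2)%E.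
  by rewrite (reindex_esum setT setT f).
by congr (esum _ _); apply/seteqP; split.
Qed.

Lemma bij_nat_pair : exists f : nat -> nat * nat, set_bij setT setT f.
Proof.
have /card_esym/ppcard_eqP[f] := card_nat2.
by exists f; exact: bij.
Qed.

(** * The outer measure [mu_star] and the Borel-Cantelli lemma *)

Section mu_star.
Context {R : realType} (p : nat -> R) (hp : forall n, 0 < p n <= 2^-1).

Definition bit_weight (i : nat) (b : bool) : R := if b then p i else 1 - p i.

Lemma bit_weight_gt0 i b : 0 < bit_weight i b.
Proof. by rewrite /bit_weight; have := hp i; case: b; lra. Qed.

Lemma bit_weight_ge_true i b : p i <= bit_weight i b.
Proof. by rewrite /bit_weight; have := hp i; case: b; lra. Qed.

Lemma cyl_weightE s :
  cyl_weight p s = \prod_(i <- iota 0 (size s)) bit_weight i (nth false s i).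
Proof. by rewrite -[size s]subn0 -/(index_iota 0 _) big_mkord. Qed.

Lemma cyl_weight_ge0 s : 0 <= cyl_weight p s.
Proof. by rewrite cyl_weightE; apply: prodr_ge0 => i _; exact/ltW/bit_weight_gt0. Qed.

Lemma cyl_weight_rcons s b :
  cyl_weight p (rcons s b) = cyl_weight p s * bit_weight (size s) b.
Proof.
rewrite !cyl_weightE size_rcons -addn1 iotaD big_cat /= big_seq1 add0n.
rewrite nth_rcons ltnn eqxx; congr (_ * _).
apply: eq_big_seq => i; rewrite mem_iota /= add0n => si.
by rewrite nth_rcons si.
Qed.

Lemma cyl_weight_small (e : R) : 0 < e -> exists s, cyl_weight p s <= e.
Proof.
move=> e0.
(* Prefixes of ones work: each of their bits has weight [p i <= 1/2]. *)
have key n : cyl_weight p (nseq n true) <= 2^-1 ^+ n.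
  elim: n => [|n IH]; first by rewrite /cyl_weight big_ord0 expr0.
  rewrite -addn1 nseqD cats1 cyl_weight_rcons exprD expr1 ler_pM ?cyl_weight_ge0//.
    exact/ltW/bit_weight_gt0.
  by rewrite /bit_weight; have := hp (size (nseq n true)); lra.
have [n nP] := ltr_add_invr (y := 0) (x := e) e0.
exists (nseq n true); apply: (le_trans (key n)).
rewrite add0r in nP; apply: le_trans (ltW nP).
rewrite exprVn lef_pV2 ?posrE ?exprn_gt0//.
by rewrite -natrX ler_nat ltn_expl.
Qed.

Lemma mu_star_le_cover A (c : nat -> seq bool) : A `<=` \bigcup_k cyl (c k) ->
  (mu_star p A <= \sum_(k <oo) (cyl_weight p (c k))%:E)%E.
Proof. by move=> Ac; apply: ereal_inf_lbound; exists c. Qed.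

Lemma mu_star_ge0 A : (0 <= mu_star p A)%E.
Proof.
apply: le_ereal_inf_tmp => _ [c _ <-].
by apply: nneseries_ge0 => k _ _; rewrite lee_fin cyl_weight_ge0.
Qed.

(* Used as padding: a cover in [mu_star] is an infinite sequence of cylinders, none
   of them empty. *)
Lemma small_cylinders (e : R) : 0 < e ->
  exists c : nat -> seq bool, (\sum_(k <oo) (cyl_weight p (c k))%:E <= e%:E)%E.
Proof.
move=> e0.
have h k : exists s, cyl_weight p s <= e / (2 ^ k.+1)%:R.
  by apply: cyl_weight_small; rewrite divr_gt0// ltr0n expn_gt0.
have [c cP] := choice h; exists c.
apply: le_trans (epsilon_trick0 xpredT (ltW e0)).
by apply: lee_nneseries => k *; rewrite lee_fin ?cyl_weight_ge0.
Qed.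

Lemma mu_star0 : mu_star p set0 = 0%E.
Proof.
apply/eqP; rewrite eq_le mu_star_ge0 andbT; apply/lee_addgt0Pr => e e0.
have [c cP] := small_cylinders e0.
by rewrite add0e (le_trans (@mu_star_le_cover _ c _) cP).
Qed.

Lemma mu_star_mono : {homo mu_star p : A B / A `<=` B >-> (A <= B)%E}.
Proof.
move=> A B AB; apply: le_ereal_inf_tmp => _ [c Bc <-].
by apply: mu_star_le_cover; exact: subset_trans Bc.
Qed.

Lemma mu_star_cyl s : (mu_star p (cyl s) <= (cyl_weight p s)%:E)%E.
Proof.
apply/lee_addgt0Pr => e e0.
have [c cP] := small_cylinders e0.
pose d k := if k is k'.+1 then c k' else s.
have sd : cyl s `<=` \bigcup_k cyl (d k) by move=> x xs; exists 0%N.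
apply: (le_trans (mu_star_le_cover sd)).
rewrite nneseries_recl//; last by move=> *; rewrite lee_fin cyl_weight_ge0.
rewrite leeD2l//= -nneseries_addn; last by move=> *; rewrite lee_fin cyl_weight_ge0.
by under eq_eseriesr do rewrite addn1 /=.
Qed.

Lemma mu_star_adherent A (e : R) : 0 < e -> mu_star p A \is a fin_num ->
  exists2 c : nat -> seq bool, A `<=` \bigcup_k cyl (c k) &
  (\sum_(k <oo) (cyl_weight p (c k))%:E <= mu_star p A + e%:E)%E.
Proof.
move=> e0 fA; have [_ [c Ac <-] /ltW cP] := lb_ereal_inf_adherent e0 fA.
by exists c.
Qed.

Lemma mu_star_sigma_subadditive : sigma_subadditive (mu_star p).
Proof.
move=> A; have [[i ioo]|] := pselect (exists i, mu_star p (A i) = +oo%E).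
  rewrite (eseries_pinfty _ _ ioo) ?leey// => n _.
  by rewrite -ltNye (lt_le_trans _ (mu_star_ge0 _)).
rewrite -forallNE => Aoo.
apply/lee_addgt0Pr => e e0.
apply: le_trans (epsilon_trick _ (fun n => mu_star_ge0 (A n)) (ltW e0)).
have h n : exists c : nat -> seq bool, A n `<=` \bigcup_k cyl (c k) /\
    (\sum_(k <oo) (cyl_weight p (c k))%:E <= mu_star p (A n) + (e / (2 ^ n.+1)%:R)%:E)%E.
  have en : 0 < e / (2 ^ n.+1)%:R by rewrite divr_gt0// ltr0n expn_gt0.
  have [|c ? ?] := @mu_star_adherent (A n) _ en; last by exists c.
  by rewrite ge0_fin_numE ?mu_star_ge0// ltey; apply/eqP.
have [c cP] := choice h.
have [f fbij] := bij_nat_pair.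
apply: (@le_trans _ _ (\sum_(i <oo) \sum_(j <oo) (cyl_weight p (c i j))%:E)%E).
  rewrite -(@esum_flatten _ f (fun i j => (cyl_weight p (c i j))%:E))//.
    apply: (@mu_star_le_cover _ (fun k => c (f k).1 (f k).2)) => x [n _ /(cP n).1 [k _ xk]].
    have [_ _ surj] := fbij; have [m _ fm] := surj (n, k) I.
    by exists m => //; rewrite fm.
  by move=> *; rewrite lee_fin cyl_weight_ge0.
apply: lee_nneseries => [i _ _|i _]; last exact: (cP i).2.
by apply: nneseries_ge0 => *; rewrite lee_fin cyl_weight_ge0.
Qed.

Definition mu_outer : {outer_measure set (nat -> bool) -> \bar R} :=
  HB.pack (mu_star p) (isOuterMeasure.Build R (nat -> bool) (mu_star p)
    mu_star0 mu_star_ge0 mu_star_mono mu_star_sigma_subadditive).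

Lemma mu_starU A B : (mu_star p (A `|` B) <= mu_star p A + mu_star p B)%E.
Proof. exact: (outer_measureU2 mu_outer). Qed.

Lemma mu_star_setT_le1 : (mu_star p setT <= 1)%E.
Proof.
have := mu_star_cyl [::]; rewrite /cyl_weight big_ord0.
by apply: le_trans; apply: mu_star_mono => x _ i.
Qed.

Lemma mu_star_fin A : mu_star p A \is a fin_num.
Proof.
rewrite ge0_fin_numE ?mu_star_ge0//; apply: le_lt_trans (ltry 1).
by apply: le_trans mu_star_setT_le1; exact: mu_star_mono.
Qed.

Lemma null_mu_measurable A : mu_star p A = 0%E -> mu_measurable p A.
Proof.
move=> A0; apply: (@le_caratheodory_measurable _ _ mu_outer) => X.
rewrite (_ : mu_outer (X `&` A) = 0%E).
  by rewrite add0e; apply: mu_star_mono; exact: subIsetl.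
by apply/eqP; rewrite eq_le mu_star_ge0 andbT -A0; apply: mu_star_mono; exact: subIsetr.
Qed.

Lemma borel_cantelli_null A (H : nat -> set (nat -> bool)) :
  (\sum_(1 <= n <oo) mu_star p (H n) < +oo)%E ->
  (forall x, A x -> infinite_set [set n | H n x]) -> mu_star p A = 0%E.
Proof.
move=> sH AH; apply/eqP; rewrite eq_le mu_star_ge0 andbT.
(* The given series starts at [1]; its missing term at [0] is finite, so the whole series converges
   and its tails tend to [0]. *)
have s0 : (\sum_(0 <= n <oo) mu_star p (H n) < +oo)%E.
  rewrite (nneseries_split 0 1); last by move=> *; exact: mu_star_ge0.
  rewrite add0n big_nat1 lte_add_pinfty//.
  by have := mu_star_fin (H 0%N); rewrite ge0_fin_numE ?mu_star_ge0.
have lim0 := nneseries_tail_cvg s0 (fun k _ => mu_star_ge0 (H k)).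
rewrite -(cvg_lim _ lim0)//; apply: lime_ge.
  by apply/cvg_ex; exists 0%E.
apply: nearW => N.
apply: le_trans (outer_measure_sigma_subadditive_tail mu_outer N H).
apply: mu_star_mono => x /AH /infinite_natP /(_ N) [n Nn Hn].
by exists n => //=; apply/negP; rewrite -leqNgt.
Qed.
End mu_star.

(** * Integration over finitely many coordinates *)

Definition upd (x : nat -> bool) (i : nat) (b : bool) : nat -> bool :=
  fun k => if k == i then b else x k.

Definition mix (r : seq nat) (x y : nat -> bool) : nat -> bool :=
  fun i => if i \in r then x i else y i.

(** The value type is arbitrary so that one notion covers events, seen as functions to [Prop], and
    real functions. *)
Definition window (T : Type) (r : seq nat) (f : (nat -> bool) -> T) :=
  forall x y, {in r, x =1 y} -> f x = f y.

Section integration.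
Context {R : realType} (p : nat -> R) (hp : forall n, 0 < p n <= 2^-1).
Local Notation bw := (bit_weight p).
Implicit Types (f g : (nat -> bool) -> R) (x y : nat -> bool) (r : seq nat).

Definition integ1 (i : nat) f : (nat -> bool) -> R :=
  fun x => p i * f (upd x i true) + (1 - p i) * f (upd x i false).

(* Integrates out the coordinates in [r], the other ones being read off the argument. *)
Definition integ r f := foldr integ1 f r.

Definition prob r (E : set (nat -> bool)) := integ r (\1_E).

Lemma integ_cat r1 r2 f : integ (r1 ++ r2) f = integ r1 (integ r2 f).
Proof. exact: foldr_cat. Qed.

Lemma integ_le r f g : (forall x, f x <= g x) -> forall x, integ r f x <= integ r g x.
Proof.
move=> fg; elim: r => //= i r IH x; rewrite /integ1.
have := hp i => hi; apply: lerD; apply: ler_wpM2l => //; lra.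
Qed.

Lemma integD r f g : integ r (f \+ g) = integ r f \+ integ r g.
Proof.
elim: r => //= i r ->; apply/funext => x; rewrite /integ1 /=; ring.
Qed.

Lemma integZ r (c : R) f : integ r (fun x => c * f x) = (fun x => c * integ r f x).
Proof.
elim: r => //= i r ->; apply/funext => x; rewrite /integ1 /=; ring.
Qed.

Lemma integ_cst r (c : R) x : integ r (fun=> c) x = c.
Proof. elim: r x => //= i r IH x; rewrite /integ1 !IH; ring. Qed.

Lemma integ_ge0 r f : (forall x, 0 <= f x) -> forall x, 0 <= integ r f x.
Proof. by move=> f0 x; rewrite -(integ_cst r 0 x); exact: integ_le. Qed.

Lemma integ_le_cst r f (c : R) : (forall x, f x <= c) -> forall x, integ r f x <= c.
Proof. by move=> fc x; rewrite -(integ_cst r c x); exact: integ_le. Qed.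

Lemma integ_sum (I : Type) (s : seq I) r (F : I -> (nat -> bool) -> R) x :
  integ r (fun y => \sum_(k <- s) F k y) x = \sum_(k <- s) integ r (F k) x.
Proof.
elim: s x => [|k s IH] x.
  rewrite big_nil (_ : (fun _ => _) = fun=> 0) ?integ_cst//.
  by apply/funext => y; rewrite big_nil.
rewrite big_cons -IH (_ : (fun _ => _) = F k \+ (fun y => \sum_(k <- s) F k y)) ?integD//.
by apply/funext => y; rewrite big_cons.
Qed.

Lemma updC x i j b c : i != j -> upd (upd x i b) j c = upd (upd x j c) i b.
Proof.
move=> ij; apply/funext => k; rewrite /upd.
by case: (k =P j) => [->|//]; rewrite eq_sym (negbTE ij).
Qed.

Lemma integ1C i j f : integ1 i (integ1 j f) = integ1 j (integ1 i f).
Proof.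
have [->//|ij] := eqVneq i j; apply/funext => x.
by rewrite /integ1 !(updC _ _ _ ij); ring.
Qed.

Lemma integC r s f : integ r (integ s f) = integ s (integ r f).
Proof.
have h i t g : integ1 i (integ t g) = integ t (integ1 i g).
  by elim: t g => //= j t IH g; rewrite integ1C IH.
by elim: r => //= i r ->; rewrite h.
Qed.

Lemma integ_mix r f x z : integ r (fun y => f (mix r y z)) x = integ r f z.
Proof.
(* Generalized for the induction: [r'] is the original list and [r] what remains of it; [w] carries
   the coordinates of [r'] already processed, as set in [x], and agrees with [z] outside [r']. *)
suff h r' w : {subset r <= r'} -> (forall i, i \notin r -> i \in r' -> x i = w i) ->
    (forall i, i \notin r' -> w i = z i) ->
    integ r (fun y => f (mix r' y z)) x = integ r f w.
  by apply: (h r z) => // i /negbTE ->.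
elim: r x w => [|i r IH] x w rr xw wz /=.
  congr (f _); apply/funext => i; rewrite /mix; case: ifPn => ir'; first exact: xw.
  by rewrite wz.
rewrite /integ1; congr (_ * _ + _ * _); apply: IH.
- by move=> j jr; apply: rr; rewrite inE jr orbT.
- by move=> j jr jr'; rewrite /upd; case: eqP => // /eqP ji; apply: xw => //; rewrite inE negb_or ji.
- by move=> j jr'; rewrite /upd; case: eqP => [ji|_]; [move: jr'; rewrite ji rr// mem_head | exact: wz].
- by move=> j jr; apply: rr; rewrite inE jr orbT.
- by move=> j jr jr'; rewrite /upd; case: eqP => // /eqP ji; apply: xw => //; rewrite inE negb_or ji.
- by move=> j jr'; rewrite /upd; case: eqP => [ji|_]; [move: jr'; rewrite ji rr// mem_head | exact: wz].
Qed.

(** By [integ_mix] both integrals can be taken from the same base point, where their integrands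
    coincide. *)
Lemma window_integ r s f : window (r ++ s) f -> window s (integ r f).
Proof.
move=> wf x y xy; rewrite -(integ_mix _ _ x x) -(integ_mix _ _ x y).
congr (integ r _ x); apply/funext => z; apply: wf => i; rewrite mem_cat /mix.
by case: ifPn => //= _ /xy.
Qed.

(** Independence of distinct coordinates: the factor of the head is constant for the integral over
    the tail and comes out of it. *)
Lemma integ_prod r (h : nat -> bool -> R) x : uniq r ->
  integ r (fun y => \prod_(i <- r) h i (y i)) x =
  \prod_(i <- r) (p i * h i true + (1 - p i) * h i false).
Proof.
elim: r x => [|i r IH] x /=; first by rewrite !big_nil.
move=> /andP[ir ur]; rewrite big_cons -(IH x ur).
have key y : integ r (fun y => \prod_(j <- i :: r) h j (y j)) y =
    h i (y i) * integ r (fun y => \prod_(j <- r) h j (y j)) y.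
  pose P z := \prod_(j <- r) h j (z j).
  rewrite -/P -(integ_mix r P y y).
  rewrite -[RHS]/((fun w => h i (y i) * integ r (fun z => P (mix r z y)) w) y).
  rewrite -integZ -[LHS](integ_mix r _ y y).
  congr (integ r _ y); apply/funext => z; rewrite big_cons; congr (h i _ * _).
  by rewrite /mix (negbTE ir).
have w : window r (fun y => \prod_(j <- r) h j (y j)).
  by move=> y z yz; apply: eq_big_seq => j jr; rewrite yz.
have {}w y : integ r (fun y => \prod_(j <- r) h j (y j)) y =
             integ r (fun y => \prod_(j <- r) h j (y j)) x.
  by apply: (@window_integ r [::]) => //; rewrite cats0.
rewrite /integ1 !key /upd !eqxx !w; ring.
Qed.

Lemma prob_ge0 r E x : 0 <= prob r E x.
Proof. by apply: integ_ge0 => y; rewrite indicE ler0n. Qed.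

Lemma probU r (E G : set (nat -> bool)) x : prob r (E `|` G) x <= prob r E x + prob r G x.
Proof.
rewrite -[leRHS]/((prob r E \+ prob r G) x) /prob -integD; apply: integ_le => y.
rewrite /= !indicE in_setU -natrD ler_nat.
by case: (y \in E); case: (y \in G).
Qed.

(** Markov's inequality, set up so that a mean of [e ^+ 2] gives [e] both as threshold and as
    probability. *)
Lemma markov_integ r f (e : R) x : 0 < e -> (forall y, 0 <= f y) ->
  integ r f x <= e ^+ 2 -> prob r [set y | e < f y] x <= e.
Proof.
move=> e0 f0 fe; rewrite -(ler_pM2l e0) -expr2; apply: le_trans fe.
rewrite /prob -[leLHS]/((fun y => e * integ r \1_[set y | e < f y] y) x) -integZ.
apply: integ_le => y; rewrite indicE; case: (boolP (_ \in _)) => [/set_mem /= /ltW|_].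
  by rewrite mulr1.
by rewrite mulr0.
Qed.

Lemma window_indic r (E : set (nat -> bool)) : window r E -> window r (\1_E : _ -> R).
Proof. by move=> wE x y xy; rewrite !indicE; congr (_%:R); apply: congr1; apply/idP/idP => /set_mem Ex; apply/mem_set; rewrite ?(wE x y xy)// -(wE x y xy). Qed.

(** The bridge from finite integrals to [mu_star]. Splitting [cyl s] by its next bit and using
    subadditivity lowers [l]; at [l = 0] the event contains or misses all of [cyl s]. *)
Lemma mu_star_cyl_prob l (s : seq bool) (U : set (nat -> bool)) x :
  window (iota 0 (size s + l)) U -> cyl s x ->
  (mu_star p (U `&` cyl s) <= (cyl_weight p s * prob (iota (size s) l) U x)%:E)%E.
Proof.
elim: l s x => [|l IH] s x wU sx /=.
  rewrite addn0 in wU; rewrite /prob /= indicE.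
  case: (boolP (x \in U)) => [_|/negP xU].
    by rewrite mulr1; apply: le_trans (mu_star_cyl hp s); apply: mu_star_mono; exact: subIsetr.
  rewrite mulr0 (_ : U `&` cyl s = set0) ?mu_star0//.
  rewrite -subset0 => y [Uy sy]; apply: xU; apply/mem_set.
  rewrite (wU x y)// => i; rewrite mem_iota /= add0n => si.
  by rewrite (sx i si) (sy i si).
have step b : cyl (rcons s b) (upd x (size s) b).
  move=> i; rewrite size_rcons ltnS leq_eqVlt nth_rcons /upd => /orP[/eqP ->|si].
    by rewrite ltnn eqxx.
  by rewrite si (ltn_eqF si) sx.
have -> : U `&` cyl s = (U `&` cyl (rcons s true)) `|` (U `&` cyl (rcons s false)).
  rewrite -setIUr; congr (_ `&` _); apply/seteqP; split => [y sy|y].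
    have : cyl (rcons s (y (size s))) y.
      move=> i; rewrite size_rcons ltnS leq_eqVlt nth_rcons => /orP[/eqP ->|si].
        by rewrite ltnn eqxx.
      by rewrite si sy.
    by case: (y (size s)); [left|right].
  by case=> h i si; have := h i; rewrite size_rcons nth_rcons si; apply; rewrite ltnW.
apply: (le_trans (mu_starU hp _ _)).
have wU' b : window (iota 0 (size (rcons s b) + l)) U by rewrite size_rcons addSnnS.
apply: (le_trans (leeD (IH _ _ (wU' true) (step true)) (IH _ _ (wU' false) (step false)))).
rewrite -EFinD lee_fin !cyl_weight_rcons !size_rcons /prob /= /integ1 /bit_weight /=.
by rewrite -!mulrA -mulrDr.
Qed.

Lemma mu_star_prob l (U : set (nat -> bool)) x :
  window (iota 0 l) U -> (mu_star p U <= (prob (iota 0 l) U x)%:E)%E.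
Proof.
move=> wU; have := @mu_star_cyl_prob l [::] U x wU.
rewrite /cyl_weight big_ord0 mul1r (_ : U `&` cyl [::] = U); first by apply.
by apply/seteqP; split => [y []//|y Uy]; split.
Qed.

End integration.

(** * Blocks of consecutive coordinates and finiteness facts *)

Definition block (n : nat -> nat) (j : nat) : seq nat := index_iota (n j) (n j.+1).

Lemma block_inj n i j k : (forall j, (n j <= n j.+1)%N) ->
  i \in block n j -> i \in block n k -> j = k.
Proof.
move=> nS; have mon := homo_leq leqnn leq_trans nS.
rewrite !mem_index_iota => /andP[ji ij] /andP[ki ik].
have [jk|kj|//] := ltngtP j k.
  by have := leq_trans ij (leq_trans (mon _ _ jk) ki); rewrite ltnn.
by have := leq_trans ik (leq_trans (mon _ _ kj) ji); rewrite ltnn.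
Qed.

Lemma sub_window (T : Type) (r s : seq nat) (f : (nat -> bool) -> T) :
  {subset r <= s} -> window r f -> window s f.
Proof. by move=> rs wf x y xy; apply: wf => i /rs /xy. Qed.

Lemma mix_notin r x y i : i \notin r -> mix r x y i = y i.
Proof. by rewrite /mix => /negbTE ->. Qed.

Lemma not_infiniteP (T : Type) (F : set T) (H : nat -> set T) :
  ~ (forall x, F x -> infinite_set [set n | H n x]) ->
  exists x, F x /\ exists N, forall n, (N <= n)%N -> ~ H n x.
Proof.
move=> /existsNP[x /not_implyP[Fx fin]]; exists x; split => //.
apply: contrapT => h; apply: fin; apply/infinite_natP => N.
apply: contrapT => hN; apply: h; exists N => n Nn Hn; apply: hN.
by exists n.
Qed.

Lemma finite_subsets (s : seq nat) : finite_set [set a : set nat | a `<=` [set` s]].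
Proof.
pose f (m : (size s).-tuple bool) : set nat := [set` mask m s].
apply: sub_finite_set (finite_image f (@finite_finset _ setT)) => a sa.
exists (map_tuple (fun i => `[< a i >]) (in_tuple s)) => //=.
rewrite /f /= -filter_mask; apply/seteqP; split => i /=.
  by rewrite mem_filter => /andP[/asboolP].
by move=> ai; rewrite mem_filter (sa i ai) andbT; apply/asboolP.
Qed.

(** * Finite families from block events, and null sets as limsups of two-block events *)

Section null_filters.
Context {R : realType} (p : nat -> R) (hp : forall n, 0 < p n <= 2^-1).

Definition filter_witness (F : set (nat -> bool)) := exists A : nat -> set (set nat),
  [/\ (forall n, finite_set (A n) /\ forall a, A n a -> finite_set a),
      (forall n m, n <> m -> \bigcup_(a in A n) a `&` \bigcup_(a in A m) a = set0),
      (\sum_(1 <= n <oo) mu_star p (hits (A n)) < +oo)%E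
    & forall X, F X -> infinite_set [set n | hits (A n) X]].

Lemma small_upclosed_witness (F : set (nat -> bool)) (b : nat -> seq nat)
    (T : nat -> set (nat -> bool)) :
  (forall X Y : nat -> bool, F X -> (forall i, X i -> Y i) -> F Y) ->
  (forall i j k, i \in b j -> i \in b k -> j = k) ->
  (forall k, window (b k) (T k)) ->
  (\sum_(1 <= k <oo) mu_star p (T k) < +oo)%E ->
  (forall X, F X -> infinite_set [set k | T k X]) ->
  filter_witness F.
Proof.
move=> Fup bdisj wT sumT FT.
(* The traces on [b k] that force [T k] for all their supersets, so that [hits (A k)] is contained
   in [T k]. *)
pose A k := [set a : set nat | a `<=` [set` b k] /\
  forall y : nat -> bool, {in b k, forall i, a i -> y i} -> T k y].
exists A; split.
- move=> k; split => [|a [ab _]]; last exact: sub_finite_set ab (finite_seq _).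
  by apply: sub_finite_set (finite_subsets (b k)) => a [].
- move=> j k jk; rewrite -subset0 => i [[a [aj _] ai] [a' [ak _] a'i]].
  by apply: jk; apply: (bdisj i); [exact: aj | exact: ak].
- apply: le_lt_trans sumT; apply: lee_nneseries => [*|k _]; first exact: mu_star_ge0.
  by apply: mu_star_mono => // x [a [_ aT] ax]; apply: aT => i _ /ax.
move=> X FX; apply: contrapT => Xfin.
have [N NP] : exists N, forall k, (N <= k)%N -> ~ hits (A k) X.
  apply: contrapT => h; apply: Xfin; apply/infinite_natP => N.
  apply: contrapT => hN; apply: h; exists N => k Nk hk; apply: hN.
  by exists k.
have yP k : exists y : nat -> bool, (N <= k)%N ->
    {in b k, forall i, X i -> y i} /\ ~ T k y.
  have [Nk|//] := leqP N k; last by exists X.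
  apply: contrapT => h; apply: (NP k Nk); exists [set i | i \in b k /\ X i].
    split => [i []//|y yX]; apply: contrapT => nT; apply: h; exists y => _; split => // i ib Xi.
    exact: yX.
  by move=> i [].
have [y {}yP] := choice yP.
(* If [X] hits no [A k] with [k >= N], each such block has a superset [y k] of [X] on it escaping
   [T k]. Since the blocks are disjoint, these glue to a superset [Z] of [X], which is in [F] but in
   no [T k] with [k >= N]. *)
pose Z i := `[< X i \/ exists k, [/\ (N <= k)%N, i \in b k & y k i] >].
have FZ : F Z by apply: Fup FX _ => i Xi; apply/asboolP; left.
have /infinite_natP /(_ N) [k Nk] := FT Z FZ.
have [yX nT] := yP k Nk; rewrite /= (wT k _ (y k))// => i ib.
apply/asboolP/idP => [[/yX|[j [_ ij]]]|yi]; first exact.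
  by rewrite (bdisj _ _ _ ib ij).
by right; exists k.
Qed.

Lemma mu_star_window a l (U : set (nat -> bool)) (e : R) : window (iota a l) U ->
  (forall x, prob p (iota a l) U x <= e) -> (mu_star p U <= e%:E)%E.
Proof.
move=> wU Ue; apply: le_trans (mu_star_prob hp (l := a + l) (fun=> false) _) _.
  by apply: sub_window wU => i; rewrite iotaD mem_cat add0n orbC => ->.
rewrite lee_fin iotaD /prob integ_cat; apply: integ_le_cst => // x; exact: Ue.
Qed.

Lemma min_weight_gt0 n : 0 < \prod_(i <- iota 0 n) p i.
Proof. by apply: prodr_gt0 => i _; case/andP: (hp i). Qed.

(** Since [p i <= 1/2], either value of bit [i] has weight at least [p i], so the product of the
    [p i] below [n] is at most the weight of the bits of [c] below [n]. The remaining bits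
    contribute the probability, by independence. *)
Lemma prob_agree n l (c : seq bool) x : (size c <= n + l)%N ->
  (\prod_(i <- iota 0 n) p i) *
    prob p (iota n l) [set y | forall i, (n <= i < size c)%N -> y i = nth false c i] x
  <= cyl_weight p c.
Proof.
move=> cnl; set E := [set y | _].
(* Positions beyond the end of [c] impose nothing and get factor [1], so [n] may exceed [size c]. *)
pose h i b : R := if (i < size c)%N then (b == nth false c i)%:R else 1.
pose g i := p i * h i true + (1 - p i) * h i false.
have gE i : g i = if (i < size c)%N then bit_weight p i (nth false c i) else 1.
  rewrite /g /h /bit_weight; case: ifP => _; last by ring.
  by case: (nth _ _ _); rewrite /= !(mulr1, mulr0) ?addr0 ?add0r.
have prE : prob p (iota n l) E x <= \prod_(i <- iota n l) g i.
  rewrite -(integ_prod p h x) ?iota_uniq//; apply: integ_le => // y; rewrite indicE.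
  case: (boolP (y \in E)) => [/set_mem Ey|_]; last first.
    by apply: prodr_ge0 => i _; rewrite /h; case: ifP.
  rewrite big_seq big1// => i; rewrite mem_iota /h => /andP[ni _]; case: ifP => // ic.
  by rewrite (Ey i) ?ni// eqxx.
have wE : cyl_weight p c = (\prod_(i <- iota 0 n) g i) * \prod_(i <- iota n l) g i.
  rewrite -{2}[n]add0n -big_cat -iotaD -(subnKC cnl) iotaD big_cat /= cyl_weightE.
  rewrite [X in _ = _ * X]big_seq [X in _ = _ * X]big1 ?mulr1.
    by apply: eq_big_seq => i; rewrite mem_iota /= gE => ->.
  by move=> i; rewrite mem_iota add0n gE => /andP[ci _]; rewrite ltnNge ci.
have g0 i : 0 <= g i by rewrite gE; case: ifP => // _; apply/ltW/bit_weight_gt0.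
rewrite wE; apply: ler_pM => //; [exact/ltW/min_weight_gt0|exact: prob_ge0|].
apply: ler_prod => i _; have := hp i => /andP[p0 p1]; rewrite ltW//= gE.
case: ifP => _; [exact: bit_weight_ge_true | lra].
Qed.

(** Merge covers of total weight at most [2^-(m+1)], one for each [m]. A point of [N] lies in some
    cylinder of every cover, hence in cylinders of infinitely many indices. *)
Lemma null_limsup_cylinders (N : set (nat -> bool)) : mu_star p N = 0%E ->
  exists2 c : nat -> seq bool, (\sum_(k <oo) (cyl_weight p (c k))%:E < +oo)%E &
    forall x, N x -> infinite_set [set k | cyl (c k) x].
Proof.
move=> N0.
have h m : exists c : nat -> seq bool, N `<=` \bigcup_k cyl (c k) /\
    (\sum_(k <oo) (cyl_weight p (c k))%:E <= (1 / (2 ^ m.+1)%:R)%:E)%E.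
  have e0 : (0 : R) < 1 / (2 ^ m.+1)%:R by rewrite divr_gt0// ltr0n expn_gt0.
  have [|c ? cP] := @mu_star_adherent R p N _ e0; first by rewrite N0.
  by exists c; split => //; rewrite N0 add0e in cP.
have [c cP] := choice h; have [f fbij] := bij_nat_pair.
have w0 s : (0 <= (cyl_weight p s)%:E)%E by rewrite lee_fin cyl_weight_ge0.
exists (fun k => c (f k).1 (f k).2) => [|x Nx].
  rewrite (@esum_flatten _ f (fun i j => (cyl_weight p (c i j))%:E))//.
  apply: (@le_lt_trans _ _ 1%:E); last exact: ltry.
  apply: le_trans (epsilon_trick0 xpredT ler01); apply: lee_nneseries => [i _ _|i _].
    by apply: nneseries_ge0.
  exact: (cP i).2.
move=> fin; apply: infinite_nat.
apply: sub_finite_set (finite_image (fst \o f) fin) => m _.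
have [k _ xk] := (cP m).1 _ Nx; have [_ _ surj] := fbij.
by have [j _ fj] := surj (m, k) I; exists j; rewrite /= fj.
Qed.

(* [n j] bounds the lengths of the cylinders of index below [L j.-1], and [L j] is so
   large that the cylinders of index at least [L j] remain unlikely when
   conditioned on any values of the first [n j] coordinates. *)
Lemma null_two_block_events (N : set (nat -> bool)) (eta : nat -> R) :
  mu_star p N = 0%E -> (forall j, 0 < eta j) ->
  exists n E, [/\ forall j, (n j <= n j.+1)%N,
    forall j, window (block n j ++ block n j.+1) (E j),
    forall j x, prob p (block n j ++ block n j.+1) (E j) x <= eta j ^+ 2 &
    forall x, N x -> infinite_set [set j | E j x]].
Proof.
move=> N0 eta0; have [c sc Nc] := null_limsup_cylinders N0.
have w0 s : (0 <= (cyl_weight p s)%:E)%E by rewrite lee_fin cyl_weight_ge0.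
pose wmin n := \prod_(i <- iota 0 n) p i.
have wmin0 n : 0 < wmin n := min_weight_gt0 n.
have tail j n : exists K, forall a b, (K <= a)%N ->
    \sum_(a <= k < b) cyl_weight p (c k) <= eta j ^+ 2 * wmin n.
  have e0 : 0 < eta j ^+ 2 * wmin n by rewrite mulr_gt0// exprn_gt0.
  have := nneseries_tail_cvg sc (fun k _ => w0 (c k)).
  move=> /fine_cvgP[[K1 _ fK] /cvgrPdist_lt /(_ _ e0)[K2 _ hK]].
  exists (maxn K1 K2) => a b; rewrite geq_max => /andP[a1 a2].
  have := hK a a2; rewrite /= sub0r normrN => /ltW h.
  apply: le_trans h; apply: le_trans (ler_norm _).
  rewrite -lee_fin fineK; last exact: fK.
  by rewrite -sumEFin; apply: nneseries_lim_ge.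
have [Kf KfP] : exists Kf : nat -> nat -> nat, forall j n a b, (Kf j n <= a)%N ->
    \sum_(a <= k < b) cyl_weight p (c k) <= eta j ^+ 2 * wmin n.
  have [g gP] := choice (fun jn : nat * nat => tail jn.1 jn.2).
  by exists (fun j n => g (j, n)) => j n; exact: gP (j, n).
pose len m := \max_(k < m) size (c k).
pose fix st j : nat * nat := if j is j'.+1 then
    let n' := maxn (st j').1 (len (st j').2) in (n', maxn (st j').2.+1 (Kf j n'))
  else (0%N, Kf 0%N 0%N).
pose n j := (st j).1; pose L j := (st j).2.
have nS j : (n j <= n j.+1)%N by exact: leq_maxl.
have LS j : (L j < L j.+1)%N by exact: leq_maxl.
have Lmon := homo_leq leqnn leq_trans (fun j => ltnW (LS j)).
have LP j b : \sum_(L j <= k < b) cyl_weight p (c k) <= eta j ^+ 2 * wmin (n j).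
  by apply: KfP; case: j => // j; exact: leq_maxr.
have sizeP j k : (k < L j)%N -> (size (c k) <= n j.+1)%N.
  move=> kL; apply: leq_trans (leq_maxr _ _).
  exact: (@leq_bigmax _ (fun k : 'I_(L j) => size (c k)) (Ordinal kL)).
pose agree j k := [set y | forall i, (n j <= i < size (c k))%N -> y i = nth false (c k) i].
(* [E j] handles the cylinders of index in [[L j, L j.+1)], forgetting their bits below [n j]. Their
   lengths are at most [n j.+2], so two blocks suffice. *)
exists n, (fun j => \bigcup_(k in [set k | (L j <= k < L j.+1)%N]) agree j k).
have blockE j : block n j ++ block n j.+1 = iota (n j) (n j.+2 - n j).
  rewrite -/(index_iota (n j) (n j.+2)) /block /index_iota.
  rewrite -{2}(subnKC (nS j)) -iotaD; congr iota.
  by have := nS j; have := nS j.+1; lia.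
split => //.
- move=> j x y xy; rewrite propeqE.
  have h z z' : {in block n j ++ block n j.+1, z =1 z'} ->
      (\bigcup_(k in [set k | (L j <= k < L j.+1)%N]) agree j k) z ->
      (\bigcup_(k in [set k | (L j <= k < L j.+1)%N]) agree j k) z'.
    move=> zz' [k /= kL zk]; exists k => // i nik; rewrite -zk// zz'//.
    rewrite blockE -/(index_iota (n j) (n j.+2)) mem_index_iota.
    have /andP[-> ik] := nik; apply: (leq_trans ik); apply: sizeP.
    by case/andP: kL.
  by split; apply: h => // i /xy.
- move=> j x; rewrite blockE.
  rewrite -(ler_pM2l (wmin0 (n j))) [leRHS]mulrC; apply: le_trans (LP j (L j.+1)).
  apply: (@le_trans _ _ (\sum_(L j <= k < L j.+1)
      wmin (n j) * prob p (iota (n j) (n j.+2 - n j)) (agree j k) x)).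
    rewrite -mulr_sumr ler_wpM2l ?(ltW (wmin0 _))// -integ_sum.
    apply: integ_le => // y; rewrite indicE.
    case: (boolP (y \in _)) => [/set_mem [k /= kL yk]|_]; last first.
      by apply: sumr_ge0 => k _; rewrite indicE.
    rewrite (big_rem k) ?mem_index_iota//= indicE mem_set//.
    by rewrite lerDl sumr_ge0// => i _; rewrite indicE.
  rewrite big_seq [leRHS]big_seq; apply: ler_sum => k; rewrite mem_index_iota => /andP[_ kL].
  apply: prob_agree; rewrite subnKC ?sizeP//.
  by have := nS j; have := nS j.+1; lia.
move=> x /Nc /infinite_natP xc; apply/infinite_natP => M.
have [k Lk xk] := xc (L M).
have Lge j : (j <= L j)%N by elim: j => // j IH; exact: leq_ltn_trans (LS j).
have kex : exists j, (k < L j)%N by exists k.+1; exact: Lge.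
have := ex_minnP kex => -[[|j] kj jmin].
  by have := leq_ltn_trans (Lmon _ _ (leq0n M)) (leq_ltn_trans Lk kj); rewrite ltnn.
have jk : (L j <= k)%N by rewrite leqNgt; apply/negP => /jmin; rewrite ltnn.
exists j.
  rewrite -ltnS ltnNge; apply/negP => /Lmon h.
  by have := leq_ltn_trans Lk kj; rewrite ltnNge h.
by exists k => /=; [rewrite jk kj | move=> i /andP[_ ik]; exact: xk].
Qed.
End null_filters.

(** * Null filters satisfy condition (2) *)

Section null_filter.
Context {R : realType} (p : nat -> R) (hp : forall n, 0 < p n <= 2^-1).

Lemma null_filter_witness (F : set (nat -> bool)) :
  (forall X Y : nat -> bool, F X -> (forall i, X i -> Y i) -> F Y) ->
  (forall X Y : nat -> bool, F X -> F Y -> F (fun i => X i && Y i)) ->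
  mu_star p F = 0%E -> filter_witness p F.
Proof.
move=> Fup FI F0.
pose eta j : R := ((2 ^ j)%:R)^-1.
have eta0 j : 0 < eta j by rewrite invr_gt0 ltr0n expn_gt0.
(* The [k]-th event on the chosen blocks will have measure at most [eta j + eta j.+1] for some
   [j >= k]; the bounds [4 / 2^(k+1)] sum to [4]. *)
have eta_sum k j : (k <= j)%N -> eta j + eta j.+1 <= 4 / (2 ^ k.+1)%:R.
  move=> kj; have h i : (k <= i)%N -> eta i <= eta k.
    by move=> ki; rewrite lef_pV2 ?posrE ?ltr0n ?expn_gt0// ler_nat leq_exp2l.
  have -> : 4 / (2 ^ k.+1)%:R = eta k + eta k.
    rewrite expnS natrM invfM /eta; set e := (_ %:R)^-1; lra.
  by apply: lerD; apply: h => //; exact: leqW.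
have sum_lty (a : nat -> R) : (forall k, a k <= 4 / (2 ^ k.+1)%:R) ->
    forall T : nat -> set (nat -> bool), (forall k, (mu_star p (T k) <= (a k)%:E)%E) ->
    (\sum_(1 <= k <oo) mu_star p (T k) < +oo)%E.
  move=> ale T Ta; apply: (@le_lt_trans _ _ 4%:E); last exact: ltry.
  apply: le_trans (epsilon_trick0 xpredT (ler0n R 4)).
  apply: (@le_trans _ _ (\sum_(0 <= k <oo) mu_star p (T k))%E).
    rewrite [leRHS](nneseries_split 0 1); last by move=> *; exact: mu_star_ge0.
    by rewrite add0n leeDr// sume_ge0// => *; exact: mu_star_ge0.
  apply: lee_nneseries => [*|k _]; first exact: mu_star_ge0.
  by apply: le_trans (Ta k) _; rewrite lee_fin.
have [n [E [nS wE pE FE]]] := null_two_block_events hp F0 eta0.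
pose b := block n.
have binj i j k : i \in b j -> i \in b k -> j = k by exact: block_inj.
(* The events involving the odd block [b k.*2.+1] are [E k.*2.+1] and [E k.*2]; integrating over the
   even neighbour gives their probability conditioned on the odd block. *)
pose Bad k := [set x | eta k.*2.+1 < integ p (b k.*2.+2) (\1_(E k.*2.+1)) x] `|`
              [set x | eta k.*2 < integ p (b k.*2) (\1_(E k.*2)) x].
have wBad k : window (b k.*2.+1) (Bad k).
  move=> x y xy.
  have w1 : window (b k.*2.+1) (integ p (b k.*2.+2) (\1_(E k.*2.+1))).
    apply: window_integ; apply: window_indic; apply: sub_window (wE _) => i.
    by rewrite !mem_cat orbC.
  have w2 : window (b k.*2.+1) (integ p (b k.*2) (\1_(E k.*2))).
    by apply: window_integ; apply: window_indic; exact: wE.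
  by rewrite /Bad /setU /mkset (w1 x y xy) (w2 x y xy).
have [badF|/not_infiniteP[X [FX [N NX]]]] :=
    pselect (forall X, F X -> infinite_set [set k | Bad k X]).
  apply: (small_upclosed_witness hp (b := fun k => b k.*2.+1) Fup) badF.
  - by move=> i j k ij ik; have := binj _ _ _ ij ik; lia.
  - exact: wBad.
  - apply: (sum_lty (fun k => eta k.*2 + eta k.*2.+1)) => [k|k].
      by apply: eta_sum; rewrite -addnn leq_addr.
    apply: (@mu_star_window _ _ hp (n k.*2.+1) (n k.*2.+2 - n k.*2.+1)).
      exact: (wBad k).
    move=> x; rewrite addrC; apply: le_trans (probU hp _ _ _ _) _; apply: lerD.
      apply: (markov_integ hp) => //; first by move=> y; exact: prob_ge0.
      by rewrite -integ_cat; exact: pE.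
    apply: (markov_integ hp) => //; first by move=> y; exact: prob_ge0.
    by rewrite integC -integ_cat; exact: pE.
(* The clause [N <= k] empties the first [T k], so that the bound below, which needs [X] not to be
   bad at [k] and [k.+1], holds for every [k]. *)
pose T k := [set x | (N <= k)%N /\ (E k.*2.+1 `|` E k.*2.+2) (mix (b k.*2.+2) x X)].
have wT k : window (b k.*2.+2) (T k).
  move=> x y xy; rewrite /T /mkset (_ : mix _ x X = mix (b k.*2.+2) y X)//.
  by apply/funext => i; rewrite /mix; case: ifP => // /xy.
have [TF|/not_infiniteP[X' [FX' [N' NX']]]] :=
    pselect (forall X, F X -> infinite_set [set k | T k X]).
  apply: (small_upclosed_witness hp (b := fun k => b k.*2.+2) Fup) TF.
  - by move=> i j k ij ik; have := binj _ _ _ ij ik; lia.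
  - exact: wT.
  - apply: (sum_lty (fun k => eta k.*2.+1 + eta k.*2.+2)) => [k|k].
      by apply: eta_sum; rewrite -addnn -addSn leq_addl.
    apply: (@mu_star_window _ _ hp (n k.*2.+2) (n k.*2.+3 - n k.*2.+2)).
      exact: (wT k).
    move=> x; have [Nk|kN] := leqP N k; last first.
      rewrite (_ : T k = set0); last first.
        by rewrite -subset0 => y [/=]; rewrite leqNgt kN.
      by rewrite /prob indic0 integ_cst addr_ge0// ltW.
    rewrite -/(index_iota _ _) -/(block n k.*2.+2) -/(b k.*2.+2).
    apply: (@le_trans _ _ (prob p (b k.*2.+2) (E k.*2.+1 `|` E k.*2.+2) X)).
      rewrite /prob -(integ_mix p (b k.*2.+2) (\1_(E k.*2.+1 `|` E k.*2.+2)) x X).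
      apply: integ_le => // y; rewrite !indicE ler_nat.
      by case: (boolP (y \in T k)) => // /set_mem [_ /mem_set ->].
    apply: le_trans (probU hp _ _ _ _) _; apply: lerD; rewrite leNgt; apply/negP => h.
      by apply: (NX k Nk); left.
    by apply: (NX k.+1 (leqW Nk)); right.
pose W i := if `[< exists k, i \in b k.*2.+2 >] then X' i else X i.
have FW : F W.
  by apply: Fup (FI _ _ FX FX') _ => i /andP[Xi X'i]; rewrite /W; case: ifP.
have Weven k : {in b k.*2.+2, W =1 X'}.
  by move=> i ik; rewrite /W; case: ifP => // /asboolP []; exists k.
have Wodd k : {in b k.*2.+1, W =1 X}.
  move=> i ik; rewrite /W; case: ifP => // /asboolP [j ij].
  by have := binj _ _ _ ik ij; lia.
have Wmix k i : i \in b k.*2.+1 ++ b k.*2.+2 ++ b k.*2.+3 -> W i = mix (b k.*2.+2) X' X i.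
  rewrite !mem_cat /mix; case: ifPn => [/Weven//|_]; rewrite orFb => /orP[/Wodd//|].
  exact: (Wodd k.+1).
(* Indices start at [1]: [E 0] involves [b 0], which no [T k] examines. For odd [j], [E j.+1] is the
   second event in [T j./2]; for even [j], the first. *)
have /infinite_natP /(_ (maxn N N').*2.+1) [[|j] // Nj EW] := FE _ FW.
have /andP[Nj2 N'j2] : (N <= j./2)%N && (N' <= j./2)%N by rewrite -geq_max; lia.
exfalso; apply: (NX' _ N'j2); split => //.
have := odd_double_half j; case: (odd j) => /= jE; rewrite -jE ?add0n ?add1n in EW.
  right; rewrite -(wE _ W)// => i ik; apply: Wmix.
  by rewrite mem_cat ik orbT.
left; rewrite -(wE _ W)// => i ik; apply: Wmix.
by move: ik; rewrite !mem_cat => /orP[]->; rewrite ?orbT.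
Qed.

End null_filter.

(** * The zero-one law for tail sets, and nullity of measurable filters *)

Section zero_one.
Context {R : realType} (p : nat -> R) (hp : forall n, 0 < p n <= 2^-1).
Implicit Types (c : nat -> seq bool) (x y : nat -> bool) (s : seq bool).

(* The measure of [cyl s] conditioned on the first [m] values of [x]. *)
Definition cond_weight m s x : R := prob p (index_iota m (size s)) (cyl s) x.

(** The potential controlling the bit-by-bit construction: a martingale by [cond_sum_step], and at
    least [1] once the first [m] values of [x] lie in a cylinder of [c]. *)
Definition cond_sum c m x : \bar R := (\sum_(k <oo) (cond_weight m (c k) x)%:E)%E.

Lemma window_cyl s : window (iota 0 (size s)) (cyl s).
Proof.
move=> x y xy; rewrite propeqE; split => h i si; rewrite -(h i si) xy// mem_iota//.
Qed.

Lemma cond_weight_ge0 m s x : 0 <= cond_weight m s x.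
Proof. exact: prob_ge0. Qed.

Lemma cond_sum_ge0 c m x : (0 <= cond_sum c m x)%E.
Proof. by apply: nneseries_ge0 => *; rewrite lee_fin cond_weight_ge0. Qed.

Lemma cond_weight0 s x : cond_weight 0 s x <= cyl_weight p s.
Proof.
have := @prob_agree _ p hp 0 (size s) s x (leqnn _).
by rewrite big_nil mul1r /cond_weight /index_iota subn0.
Qed.

Lemma cond_weight_step m s x : cond_weight m s x =
  p m * cond_weight m.+1 s (upd x m true) + (1 - p m) * cond_weight m.+1 s (upd x m false).
Proof.
rewrite /cond_weight; have [ms|sm] := ltnP m (size s).
  by rewrite /index_iota -(subnSK ms).
have nil k : (m <= k)%N -> index_iota k (size s) = [::].
  by move=> mk; apply/size0nil; rewrite size_iota; apply/eqP; rewrite subn_eq0 (leq_trans sm).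
rewrite !nil// /prob /=.
have w b : \1_(cyl s) (upd x m b) = \1_(cyl s) x :> R.
  apply: (window_indic (@window_cyl s)) => i; rewrite mem_iota add0n /upd => /andP[_ si].
  by rewrite (ltn_eqF (leq_trans si sm)).
rewrite !w; ring.
Qed.

Lemma cond_sum_step c m x : cond_sum c m x =
  ((p m)%:E * cond_sum c m.+1 (upd x m true) +
   (1 - p m)%:E * cond_sum c m.+1 (upd x m false))%E.
Proof.
have p0 : 0 <= p m <= 1 by have := hp m; lra.
rewrite /cond_sum -!nneseriesZl -?nneseriesD.
- by apply: eq_eseriesr => k _; rewrite -!EFinM -EFinD -cond_weight_step.
all: move=> *; rewrite ?mule_ge0// lee_fin ?cond_weight_ge0//; lra.
Qed.

Lemma window_cond_sum c m : window (iota 0 m) (cond_sum c m).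
Proof.
move=> x y xy; apply: eq_eseriesr => k _; congr (_%:E).
apply: (@window_integ _ _ _ (iota 0 m)) xy; apply: window_indic.
apply: sub_window (@window_cyl (c k)) => i.
rewrite mem_cat mem_index_iota !mem_iota !add0n => /andP[_ ->].
by rewrite andbT leq0n leqNgt orNb.
Qed.

Lemma cond_sum_ge1 c m x k : (size (c k) <= m)%N -> cyl (c k) x -> (1 <= cond_sum c m x)%E.
Proof.
move=> km xk; rewrite /cond_sum (nneseriesD1 (n := k))//; last first.
  by move=> *; rewrite lee_fin cond_weight_ge0.
have -> : cond_weight m (c k) x = 1.
  rewrite /cond_weight /index_iota (eqP (_ : size (c k) - m == 0)%N) ?subn_eq0//.
  by rewrite /prob /= indicE mem_set.
by rewrite leeDl// nneseries_ge0// => *; rewrite lee_fin cond_weight_ge0.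
Qed.

(** Give the bit pairs [(1,0)], [(0,1)], [(0,0)] the probabilities [t], [t], [1 - 2t] with
    [t = p m <= 1/2]. Both marginals are the law of bit [m], so the mean of the left side is the
    right side, and some pair does not exceed it. *)
Lemma disjoint_bits c m x y : exists ab : bool * bool, ~~ (ab.1 && ab.2) /\
  (cond_sum c m.+1 (upd x m ab.1) + cond_sum c m.+1 (upd y m ab.2) <=
   cond_sum c m x + cond_sum c m y)%E.
Proof.
rewrite (cond_sum_step c m x) (cond_sum_step c m y).
have ge b z : (0 <= cond_sum c m.+1 (upd z m b))%E by exact: cond_sum_ge0.
move: (ge true x) (ge false x) (ge true y) (ge false y).
have := hp m; set t := p m => ht.
have t1 : 0 < 1 - t by lra.
pose G b z := cond_sum c m.+1 (upd z m b).
rewrite -!/(G _ _) => gx1 gx0 gy1 gy0.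
suff: (G true x + G false y <= t%:E * G true x + (1 - t)%:E * G false x + (t%:E * G true y + (1 - t)%:E * G false y))%E \/
  (G false x + G true y <= t%:E * G true x + (1 - t)%:E * G false x + (t%:E * G true y + (1 - t)%:E * G false y))%E \/
  (G false x + G false y <= t%:E * G true x + (1 - t)%:E * G false x + (t%:E * G true y + (1 - t)%:E * G false y))%E.
  by move=> [h|[h|h]]; [exists (true, false) | exists (false, true) | exists (false, false)].
move: gx1 gx0 gy1 gy0.
(* An infinite value makes the right side infinite, as [t] and [1 - t] are positive; only the real
   case remains. *)
move: (G true x) (G false x) (G true y) (G false y) => [u| |] [v| |] [u'| |] [v'| |] // *;
  try by left; rewrite ?gt0_muley ?lte_fin ?(andP ht).1 //= ?leey.
rewrite -!EFinM -!EFinD !lee_fin.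
set S := (X in _ <= X \/ _).
have [|h1] := leP (u + v') S; first by left.
have [|h2] := leP (v + u') S; first by right; left.
have [|h3] := leP (v + v') S; first by right; right.
exfalso; have t0 : 0 < t by lra.
have t2 : 0 <= 1 - 2 * t by lra.
have := mulr_gt0 t0 (_ : 0 < u + v' - S); rewrite subr_gt0 => /(_ h1).
have := mulr_gt0 t0 (_ : 0 < v + u' - S); rewrite subr_gt0 => /(_ h2).
have := mulr_ge0 t2 (_ : 0 <= v + v' - S); rewrite subr_ge0 => /(_ (ltW h3)).
have : S = t * u + (1 - t) * v + (t * u' + (1 - t) * v') by [].
move: S {h1 h2 h3} => S; lra.
Qed.

Lemma disjoint_path c : exists X Y : nat -> bool, (forall i, ~~ (X i && Y i)) /\
  forall m, (cond_sum c m X + cond_sum c m Y <=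
    \sum_(k <oo) (cyl_weight p (c k))%:E + \sum_(k <oo) (cyl_weight p (c k))%:E)%E.
Proof.
have [h hP] := choice (fun mxy : nat * ((nat -> bool) * (nat -> bool)) =>
  disjoint_bits c mxy.1 mxy.2.1 mxy.2.2).
(* Stage [m] already has the final values below [m], and [cond_sum c m] depends on no others. *)
pose fix st m : (nat -> bool) * (nat -> bool) := if m is m'.+1 then
    (upd (st m').1 m' (h (m', st m')).1, upd (st m').2 m' (h (m', st m')).2)
  else (fun=> false, fun=> false).
pose X i := (st i.+1).1 i; pose Y i := (st i.+1).2 i.
have stX m i : (i < m)%N -> (st m).1 i = X i.
  elim: m => // m IH; rewrite ltnS leq_eqVlt => /orP[/eqP->//|im].
  by rewrite /= /upd (ltn_eqF im) IH.
have stY m i : (i < m)%N -> (st m).2 i = Y i.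
  elim: m => // m IH; rewrite ltnS leq_eqVlt => /orP[/eqP->//|im].
  by rewrite /= /upd (ltn_eqF im) IH.
exists X, Y; split => [i|m].
  by rewrite /X /Y /= /upd eqxx; exact: (hP (i, st i)).1.
rewrite -(@window_cond_sum c m (st m).1 X); last first.
  by move=> i; rewrite mem_iota => /andP[_]; exact: stX.
rewrite -(@window_cond_sum c m (st m).2 Y); last first.
  by move=> i; rewrite mem_iota => /andP[_]; exact: stY.
elim: m => [|m IH]; last by apply: le_trans IH; exact: (hP (m, st m)).2.
by apply: leeD; apply: lee_nneseries => *; rewrite lee_fin ?cond_weight_ge0 ?cond_weight0.
Qed.

Lemma filter_compl_not_null (F : set (nat -> bool)) :
  nonprincipal_filter F -> mu_star p (~` F) <> 0%E.
Proof.
move=> [F0 _ FI _] N0.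
(* Twice [1/4] stays below [1], whereas a set outside [F] enters a cylinder of the cover and pushes
   its potential to [1]. *)
have e0 : (0 : R) < 4^-1 by [].
have [|c Fc cP] := @mu_star_adherent _ p (~` F) _ e0; first by rewrite N0.
rewrite N0 add0e in cP.
have [X [Y [disj sumP]]] := disjoint_path c.
have lt1 m : (cond_sum c m X + cond_sum c m Y < 1)%E.
  apply: (le_lt_trans (sumP m)); apply: (le_lt_trans (leeD cP cP)).
  by rewrite -EFinD lte_fin; lra.
have FX : F X.
  apply: contrapT => /Fc [k _ Xk]; have := lt1 (size (c k)); apply/negP; rewrite -leNgt.
  by apply: (le_trans (cond_sum_ge1 (leqnn _) Xk)); rewrite leeDl// cond_sum_ge0.
have FY : F Y.
  apply: contrapT => /Fc [k _ Yk]; have := lt1 (size (c k)); apply/negP; rewrite -leNgt.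
  by apply: (le_trans (cond_sum_ge1 (leqnn _) Yk)); rewrite leeDr// cond_sum_ge0.
apply: F0; rewrite (_ : (fun _ => _) = fun i => X i && Y i); first exact: FI.
by apply/funext => i; have := disj i; case: (X i && Y i).
Qed.

Definition tail_set (F : set (nat -> bool)) :=
  forall n x y, F x -> (forall i, (n <= i)%N -> x i = y i) -> F y.

Lemma nonprincipal_filter_tail F : nonprincipal_filter F -> tail_set F.
Proof.
move=> [_ Fup FI Fcof] n x y Fx xy.
have Fn : F (fun i => (n <= i)%N).
  by apply: Fcof; apply: sub_finite_set (finite_II n) => i /=; rewrite -ltnNge.
by apply: Fup (FI _ _ Fx Fn) _ => i /andP[xi ni]; rewrite -xy.
Qed.

(** The independence half of the zero-one law. Replacing the first [size s] values of a point by
    those of a fixed [y] keeps it in [F]; so a cover of [F], pulled back along this change, still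
    covers [F], and on [cyl s] it costs the weight of [s] times the potential of [y]. *)
Lemma tail_set_cyl_le F s : tail_set F ->
  (mu_star p (F `&` cyl s) <= (cyl_weight p s)%:E * mu_star p F)%E.
Proof.
move=> tF.
suff h c : F `<=` \bigcup_k cyl (c k) -> (mu_star p (F `&` cyl s) <=
    (cyl_weight p s)%:E * \sum_(k <oo) (cyl_weight p (c k))%:E)%E.
  apply/lee_addgt0Pr => e e0.
  have w0 := cyl_weight_ge0 hp s.
  have e'0 : 0 < e / (cyl_weight p s + 1) by rewrite divr_gt0// ltr_wpDl.
  have [c Fc cP] := mu_star_adherent e'0 (mu_star_fin hp F).
  apply: (le_trans (h c Fc)); apply: (le_trans (lee_wpmul2l _ cP)); rewrite ?lee_fin//.
  rewrite ge0_muleDr ?mu_star_ge0// ?lee_fin ?(ltW e'0)// leeD2l// -EFinM lee_fin.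
  by rewrite mulrCA ler_piMr ?(ltW e0)// ler_pdivrMr ?mul1r ?lerDl// ltr_wpDl.
move=> Fc; have [X [Y [_ sumP]]] := disjoint_path c.
pose n := size s.
(* If both [X] and [Y] exceeded the total weight of the cover, so would their sum exceed twice that
   weight. *)
have [y yP] : exists y, (cond_sum c n y <= \sum_(k <oo) (cyl_weight p (c k))%:E)%E.
  have [h|h] := leP (cond_sum c n X) (\sum_(k <oo) (cyl_weight p (c k))%:E)%E.
    by exists X.
  exists Y; rewrite leNgt; apply/negP => h'.
  by have := sumP n; apply/negP; rewrite -ltNge lteD.
pose V k := [set x | cyl (c k) (mix (iota 0 n) y x)].
apply: (@le_trans _ _ (\sum_(k <oo) mu_star p (V k `&` cyl s))%E).
  apply: le_trans (mu_star_sigma_subadditive hp _); apply: mu_star_mono => x [Fx sx].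
  have /Fc [k _ xk] : F (mix (iota 0 n) y x).
    apply: (tF n x) => // i ni; rewrite mix_notin// mem_iota add0n -leqNgt//.
  by exists k.
rewrite -nneseriesZl; last by move=> *; rewrite lee_fin cyl_weight_ge0.
apply: (@le_trans _ _ (\sum_(k <oo) (cyl_weight p s)%:E * (cond_weight n (c k) y)%:E)%E); last first.
  rewrite !nneseriesZl; [|by move=> *; rewrite lee_fin ?cyl_weight_ge0 ?cond_weight_ge0..].
  by apply: lee_pmul => //; rewrite ?lee_fin ?cyl_weight_ge0// cond_sum_ge0.
apply: lee_nneseries => [*|k _]; first exact: mu_star_ge0.
have sx : cyl s (nth false s) by [].
have ksub : {subset iota 0 (size (c k)) <= iota 0 (size s + (size (c k) - size s))}.
  by move=> i; rewrite !mem_iota !add0n; lia.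
apply: (le_trans (@mu_star_cyl_prob _ _ hp (size (c k) - size s) s (V k) _ _ sx)).
  move=> x z xz; apply: window_cyl => i ik; rewrite /mix; case: ifP => // _.
  by apply: xz; exact: ksub.
rewrite -EFinM lee_fin ler_wpM2l ?cyl_weight_ge0// /cond_weight /index_iota /prob.
rewrite -(integ_mix p _ (\1_(cyl (c k))) (nth false s) y); apply: integ_le => // z.
rewrite (_ : \1_(V k) z = \1_(cyl (c k)) (mix (iota 0 n) y z))//.
rewrite le_eqVlt; apply/orP; left; apply/eqP.
apply: (window_indic (@window_cyl (c k))) => i /ksub.
rewrite iotaD mem_cat /mix add0n; case: ifPn => [i0|_ /= ->//] _.
by case: ifPn => //; move: i0; rewrite !mem_iota /n; lia.
Qed.

(** Cutting [F] along a cover of itself gives [mu_star p F <= mu_star p F * S], with [S] the total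
    weight of the cover; dividing by the positive finite [mu_star p F] gives [1 <= S]. *)
Lemma tail_set_zero_one F : tail_set F -> mu_star p F <> 0%E -> (1 <= mu_star p F)%E.
Proof.
move=> tF Fn0; have fF := mu_star_fin hp F.
have a0 : 0 < fine (mu_star p F).
  by rewrite fine_gt0// lt_neqAle mu_star_ge0// andbT eq_sym; apply/andP; split;
    [exact/eqP | rewrite -ge0_fin_numE// mu_star_ge0].
apply: le_ereal_inf_tmp => _ [c Fc <-].
have : (mu_star p F <= mu_star p F * \sum_(k <oo) (cyl_weight p (c k))%:E)%E.
  rewrite -{2}(fineK fF) -nneseriesZl; last by move=> *; rewrite lee_fin cyl_weight_ge0.
  apply: (@le_trans _ _ (\sum_(k <oo) mu_star p (F `&` cyl (c k)))%E).
    apply: le_trans (mu_star_sigma_subadditive hp _); apply: mu_star_mono => x Fx.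
    by have [k _ xk] := Fc x Fx; exists k.
  apply: lee_nneseries => [*|k _]; first exact: mu_star_ge0.
  by rewrite fineK// muleC; exact: tail_set_cyl_le.
by rewrite -{1}[mu_star p F]mule1 lee_pmul2l// -(fineK fF) lte_fin.
Qed.

Lemma measurable_filter_null F : nonprincipal_filter F -> mu_measurable p F ->
  mu_star p F = 0%E.
Proof.
move=> hF mF; apply: contrapT => Fn0.
have F1 := tail_set_zero_one (nonprincipal_filter_tail hF) Fn0.
apply: (filter_compl_not_null hF).
(* Splitting the whole space along [F]: the two parts sum to at most [1], and [F] alone already has
   [1]. *)
have := mF setT; rewrite !setTI => mT.
have := mu_star_setT_le1 hp; rewrite mT => h.
apply/eqP; rewrite eq_le mu_star_ge0// andbT.
have := le_trans (leeD2r _ F1) h.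
by rewrite -{2}[1%E]adde0 leeD2lE.
Qed.
End zero_one.

Theorem theorem1p2 (R : realType) (p : nat -> R)
  (hp : forall n, 0 < p n <= 2^-1) (F : set (nat -> bool))
  (hF : nonprincipal_filter F) :
  mu_measurable p F <->
  exists A : nat -> set (set nat),
    [/\ (forall n, finite_set (A n) /\ forall a, A n a -> finite_set a),
        (forall n m, n <> m -> \bigcup_(a in A n) a `&` \bigcup_(a in A m) a = set0),
        (\sum_(1 <= n <oo) mu_star p (hits (A n)) < +oo)%E
      & forall X, F X -> infinite_set [set n | hits (A n) X]].
Proof.
split=> [mF|[A [_ _ sumA FA]]].
  have [_ Fup FI _] := hF.
  exact: (null_filter_witness hp Fup FI (measurable_filter_null hp hF mF)).
(* Conversely, [F] lies in the limsup of events of summable measure, hence is null and so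
   measurable. *)
exact/null_mu_measurable/(borel_cantelli_null hp sumA FA).
Qed.
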